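(* Let $A$ be a two-sided skew brace. Then $A$ is prime if and only if it is strongly prime.
   Context: A skew (left) brace is a triple $(A,+,\circ)$ such that $(A,+)$ and $(A,\circ)$ are (not necessarily abelian) groups and $a\circ(b+c)=a\circ b-a+a\circ c$ for all $a,b,c\in A$. The two groups share the same identity element, denoted $0$. It is two-sided if moreover $(a+b)\circ c=a\circ c-c+b\circ c$ for all $a,b,c\in A$. An ideal of $A$ is a subset $I$ that is a normal subgroup of both $(A,+)$ and $(A,\circ)$ and satisfies $-a+a\circ x\in I$ for all $a\in A$, $x\in I$. For $a,b\in A$ put $a*b=-a+a\circ b-b$; for $X,Y\subseteq A$ let $X*Y$ be the subgroup of $(A,+)$ generated by $\{x*y\mid x\in X,y\in Y\}$. A $*$-product of finitely many ideals is any subset obtained from them by applying the operation $(X,Y)\mapsto X*Y$ with an arbitrary bracketing (this operation on subsets need not be associative). $A$ is prime if $I*J\neq\{0\}$ for all non-zero ideals $I,J$ of $A$. $A$ is strongly prime if every $*$-product of any (finite, positive) number of non-zero ideals of $A$, with any bracketing, is non-zero. *)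

(* Defs.v *)
From mathcomp Require Import all_boot.
From mathcomp Require Import classical_sets.

Set Implicit Arguments.
Unset Strict Implicit.
Unset Printing Implicit Defensive.

Local Open Scope classical_set_scope.

(* MathComp's groupType attaches a single multiplicative law to a type (and
   requires a choiceType); a skew brace carries two group laws on an arbitrary
   type, so group laws are packaged here as values. *)
Record group_law (T : Type) := GroupLaw {
  gop : T -> T -> T;
  gid : T;
  ginv : T -> T;
  gopA : forall x y z, gop x (gop y z) = gop (gop x y) z;
  gop1l : forall x, gop gid x = x;
  gop1r : forall x, gop x gid = x;
  gopVl : forall x, gop (ginv x) x = gid;
  gopVr : forall x, gop x (ginv x) = gid
}.

Definition subgroup (T : Type) (G : group_law T) (X : set T) : Prop :=
  [/\ X (gid G),
      forall x y, X x -> X y -> X (gop G x y)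
    & forall x, X x -> X (ginv G x)].

Definition normal_subgroup (T : Type) (G : group_law T) (X : set T) : Prop :=
  subgroup G X /\
  forall g x, X x -> X (gop G (gop G g x) (ginv G g)).

(* The identities of the two laws are not assumed equal: see [brace_one]. *)
Record skew_brace := SkewBrace {
  brace_sort :> Type;
  brace_add : group_law brace_sort;
  brace_circ : group_law brace_sort;
  brace_distr : forall a b c : brace_sort,
    gop brace_circ a (gop brace_add b c) =
    gop brace_add (gop brace_add (gop brace_circ a b) (ginv brace_add a))
                  (gop brace_circ a c)
}.

Declare Scope brace_scope.
Delimit Scope brace_scope with brace.
Local Open Scope brace_scope.

Notation "0" := (gid (brace_add _)) : brace_scope.
Notation "a + b" := (gop (brace_add _) a b) : brace_scope.
Notation "- a" := (ginv (brace_add _) a) : brace_scope.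
Notation "a - b" := (gop (brace_add _) a (ginv (brace_add _) b)) : brace_scope.
Notation "a ∘ b" := (gop (brace_circ _) a b)
  (at level 40, left associativity) : brace_scope.

Lemma brace_one (A : skew_brace) : gid (brace_circ A) = 0.
Proof.
have h := brace_distr (gid (brace_circ A)) 0 0; rewrite !gop1l gop1r in h.
by rewrite -[LHS](gop1r (brace_add A)) [in LHS]h gopVr.
Qed.

Definition two_sided (A : skew_brace) : Prop :=
  forall a b c : A, (a + b) ∘ c = a ∘ c - c + b ∘ c.

Definition ideal (A : skew_brace) (I : set A) : Prop :=
  [/\ normal_subgroup (brace_add A) I,
      normal_subgroup (brace_circ A) I
    & forall a x, I x -> I (- a + a ∘ x)].

Definition star (A : skew_brace) (a b : A) : A := - a + a ∘ b - b.

Definition star_set (A : skew_brace) (X Y : set A) : set A :=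
  smallest (subgroup (brace_add A)) [set star x y | x in X & y in Y].

Definition nonzero_ideal (A : skew_brace) (I : set A) : Prop :=
  ideal I /\ I <> [set 0].

(* The subsets obtained from one or more members of C (repetitions allowed) by
   iterating [star_set] with an arbitrary bracketing. *)
Inductive star_product (A : skew_brace) (C : set (set A)) : set A -> Prop :=
| star_product_factor I : C I -> star_product C I
| star_product_star X Y :
    star_product C X -> star_product C Y -> star_product C (star_set X Y).

Definition prime_brace (A : skew_brace) : Prop :=
  forall I J : set A,
    nonzero_ideal I -> nonzero_ideal J -> star_set I J <> [set 0].

Definition strongly_prime_brace (A : skew_brace) : Prop :=
  forall X : set A, star_product (@nonzero_ideal A) X -> X <> [set 0].

(* Main.v *)
(* Expanding (a + b) ∘ (c + d) by both distributive laws shows that every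
   a * d commutes additively with every -c + b∘c - b, and the latter is the
   commutator [-c, b] up to a conjugate of b * c. Let K be the additive centre
   of the ideal A * A. If K = 0, then for x in I and y in J, with I and J
   ideals inside M := A * A, the element -y + x∘y - x lies in K, hence
   vanishes, so [-y, x] belongs to I * J; if K <> 0, then additive commutators
   vanish inside M := K. Either way the commutators of I and J lie in I * J,
   which makes I * J normal in (A, +), hence an ideal. So in a prime A every
   *-product of nonzero ideals contains a nonzero ideal inside M. *)
From mathcomp Require Import all_boot.
From mathcomp Require Import boolp classical_sets.
Require Import Defs.

Set Implicit Arguments.
Unset Strict Implicit.
Unset Printing Implicit Defensive.

Local Open Scope classical_set_scope.
Local Open Scope brace_scope.

(** * Identities in a single group law *)

Section GroupLaw.
Variables (T : Type) (G : group_law T).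
Local Notation "x · y" := (gop G x y) (at level 40, left associativity).
Local Notation inv := (ginv G).

Lemma gopKV x y : inv x · (x · y) = y.
Proof. by rewrite gopA gopVl gop1l. Qed.

Lemma gopVK x y : x · (inv x · y) = y.
Proof. by rewrite gopA gopVr gop1l. Qed.

Lemma gop_injl x y z : x · y = x · z -> y = z.
Proof. by move=> e; rewrite -(gopKV x y) e gopKV. Qed.

Lemma gop_injr x y z : y · x = z · x -> y = z.
Proof.
by move=> e; rewrite -(gop1r G y) -(gopVr G x) gopA e -gopA gopVr gop1r.
Qed.

Lemma ginv_unique x y : x · y = gid G -> inv x = y.
Proof. by move=> e; apply: (@gop_injl x); rewrite gopVr e. Qed.

Lemma ginvK x : inv (inv x) = x.
Proof. by apply: ginv_unique; rewrite gopVl. Qed.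

Lemma ginv1 : inv (gid G) = gid G.
Proof. by apply: ginv_unique; rewrite gop1l. Qed.

Lemma ginvM x y : inv (x · y) = inv y · inv x.
Proof. by apply: ginv_unique; rewrite -gopA gopVK gopVr. Qed.

(* The Knuth-Bendix completion of the group axioms: rewriting with it decides
   the word problem of free groups. *)
Definition group_simp :=
  (ginvM, ginvK, ginv1, fun x y z => esym (gopA G x y z),
   gop1l G, gop1r G, gopVl G, gopVr G, gopKV, gopVK).

End GroupLaw.

(** * Endomorphisms of a group law *)

Section AdditiveMaps.
Variables (T : Type) (G : group_law T) (f : T -> T).
Hypothesis fD : forall x y, f (gop G x y) = gop G (f x) (f y).

Lemma morph_gid : f (gid G) = gid G.
Proof. by apply: (@gop_injl _ G (f (gid G))); rewrite -fD !gop1r. Qed.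

Lemma morph_ginv x : f (ginv G x) = ginv G (f x).
Proof. by apply/esym/ginv_unique; rewrite -fD gopVr morph_gid. Qed.

Lemma preimage_subgroup (Z : set T) : subgroup G Z -> subgroup G (f @^-1` Z).
Proof.
move=> [Z0 ZD ZN]; split=> [|x y|x] /=.
- by rewrite morph_gid.
- by rewrite fD; exact: ZD.
- by rewrite morph_ginv; exact: ZN.
Qed.

End AdditiveMaps.

(** * The [lam] action and the star operation *)

Section SkewBrace.
Variable A : skew_brace.
Implicit Types (a b c x y : A) (I J X Y Z : set A).

(** The usual λ-map of skew braces: the [∘]-group acts through it on the additive group by
    automorphisms ([lamD], [lam_circ], [lamV]). *)
Definition lam a b : A := - a + a ∘ b.

Definition circ_conj a b : A := a ∘ b ∘ ginv (brace_circ A) a.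

Lemma circE a b : a ∘ b = a + lam a b.
Proof. by rewrite /lam gopVK. Qed.

Lemma starE a b : star a b = lam a b - b.
Proof. by []. Qed.

Lemma circ_star a b : a ∘ b = a + star a b + b.
Proof. by rewrite /star !group_simp. Qed.

Lemma lamD a b c : lam a (b + c) = lam a b + lam a c.
Proof. by rewrite /lam brace_distr !group_simp. Qed.

Lemma circ0 a : a ∘ 0 = a.
Proof. by rewrite -brace_one gop1r. Qed.

Lemma zero_circ a : 0 ∘ a = a.
Proof. by rewrite -brace_one gop1l. Qed.

Lemma circV a : ginv (brace_circ A) a ∘ a = 0.
Proof. by rewrite gopVl brace_one. Qed.

Lemma lam_circ a b c : lam (a ∘ b) c = lam a (lam b c).
Proof.
have -> : lam b c = - b + b ∘ c by [].
by rewrite lamD (morph_ginv (lamD a)) /lam !group_simp.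
Qed.

Lemma lamV a b : lam a (lam (ginv (brace_circ A) a) b) = b.
Proof.
by rewrite -lam_circ gopVr brace_one /lam zero_circ ginv1 gop1l.
Qed.

Lemma circ_inv a : ginv (brace_circ A) a = - lam (ginv (brace_circ A) a) a.
Proof. by rewrite /lam circV !group_simp. Qed.

Lemma star_addr a b c : star a (b + c) = star a b + b + star a c - b.
Proof. by rewrite !starE lamD !group_simp. Qed.

(** Since [lam] is an action, [lam c] after [lam a] equals [lam (circ_conj c a)] after [lam c]. *)
Lemma lam_star a b c : lam c (star a b) = star (circ_conj c a) (lam c b).
Proof.
rewrite !starE lamD (morph_ginv (lamD c)) -!lam_circ /circ_conj.
by rewrite -gopA gopVl gop1r.
Qed.

(** * Additive subgroups generated by stars *)

Lemma star_set_sub_subgroup X Y Z : subgroup (brace_add A) Z ->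
  (forall a b, X a -> Y b -> Z (star a b)) -> star_set X Y `<=` Z.
Proof.
move=> Zg XYZ; apply: smallest_sub => // _ [a Xa [b Yb <-]]; exact: XYZ.
Qed.

Lemma star_set_gen X Y a b : X a -> Y b -> star_set X Y (star a b).
Proof. by move=> Xa Yb Z [_]; apply; exists a => //; exists b. Qed.

Lemma star_set_subgroup X Y : subgroup (brace_add A) (star_set X Y).
Proof.
split=> [Z [[]]//|x y hx hy Z ZXY|x hx Z ZXY].
- by case: (ZXY) => [[_ ZD _] _]; apply: ZD; [exact: hx|exact: hy].
- by case: (ZXY) => [[_ _ ZN] _]; apply: ZN; exact: hx.
Qed.

Lemma star_setS X X' Y Y' :
  X `<=` X' -> Y `<=` Y' -> star_set X Y `<=` star_set X' Y'.
Proof.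
move=> XX' YY'; apply: star_set_sub_subgroup => [|a b Xa Yb].
  exact: star_set_subgroup.
by apply: star_set_gen; [exact: XX'|exact: YY'].
Qed.

(** Reduces invariance of [star_set X Y] under additive conjugation, [lam] and [circ_conj] to a
    check on generators. *)
Lemma star_set_map (f : A -> A) X Y Z : {morph f : x y / x + y} ->
  subgroup (brace_add A) Z ->
  (forall a b, X a -> Y b -> Z (f (star a b))) ->
  forall s, star_set X Y s -> Z (f s).
Proof.
move=> fD Zg XYZ; apply: (@star_set_sub_subgroup X Y (f @^-1` Z)) => //.
exact: preimage_subgroup.
Qed.

Lemma conj_morph b : {morph (fun x => b + x - b) : x y / x + y}.
Proof. by move=> x y; rewrite !group_simp. Qed.

(** * Ideals and their closure properties *)

Lemma ideal0 I : ideal I -> I 0.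
Proof. by case=> [[[]]]. Qed.

Lemma idealD I x y : ideal I -> I x -> I y -> I (x + y).
Proof. by case=> [[[_ ID _] _] _ _]; exact: ID. Qed.

Lemma idealN I x : ideal I -> I x -> I (- x).
Proof. by case=> [[[_ _ IN] _] _ _]; exact: IN. Qed.

Lemma ideal_conj I b x : ideal I -> I x -> I (b + x - b).
Proof. by case=> [[_ In] _ _]; exact: In. Qed.

Lemma ideal_conjV I b x : ideal I -> I x -> I (- b + x + b).
Proof.
by move=> Ii Ix; rewrite -{2}[b](ginvK (brace_add A)); exact: ideal_conj.
Qed.

Lemma ideal_lam I a x : ideal I -> I x -> I (lam a x).
Proof. by case=> _ _; apply. Qed.

Lemma ideal_circ_conj I a x : ideal I -> I x -> I (circ_conj a x).
Proof. by case=> _ [_ In] _; exact: In. Qed.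

(** [circE] and [circ_inv] express [∘] and its inverse through [+], [-] and [lam], so closure under
    [∘] follows from additive closure. *)
Lemma ideal_of_invariant I : subgroup (brace_add A) I ->
  (forall b x, I x -> I (b + x - b)) ->
  (forall a x, I x -> I (lam a x)) ->
  (forall a x, I x -> I (circ_conj a x)) -> ideal I.
Proof.
move=> Ig Iconj Ilam Icirc; have [I0 ID IN] := Ig.
split=> //; split=> //; split.
- by rewrite brace_one.
- by move=> x y Ix Iy; rewrite circE; apply/ID/Ilam.
- by move=> x Ix; rewrite circ_inv; apply/IN/Ilam.
Qed.

Lemma ideal_setT : ideal [set: A].
Proof. by []. Qed.

Lemma ideal_setI I J : ideal I -> ideal J -> ideal (I `&` J).
Proof.
move=> Ii Ji; apply: ideal_of_invariant.
- split=> [|x y [Ix Jx] [Iy Jy]|x [Ix Jx]]; split;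
    by [exact: ideal0|exact: idealD|exact: idealN].
- by move=> b x [Ix Jx]; split; exact: ideal_conj.
- by move=> b x [Ix Jx]; split; exact: ideal_lam.
- by move=> b x [Ix Jx]; split; exact: ideal_circ_conj.
Qed.

Lemma ideal_starr I a x : ideal I -> I x -> I (star a x).
Proof.
by move=> Ii Ix; rewrite starE; apply: idealD (ideal_lam _ _ _) (idealN _ _).
Qed.

Lemma ideal_starl I x b : ideal I -> I x -> I (star x b).
Proof.
(* Normality in the [∘]-group moves [x] past [b]: [x ∘ b = b ∘ y] with [y] in [I]. *)
move=> Ii Ix; set y := circ_conj (ginv (brace_circ A) b) x.
have -> : star x b = - x + (b + lam b y - b).
  have e : x ∘ b = b ∘ y by rewrite /y /circ_conj !group_simp.
  by rewrite /star /lam e !group_simp.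
apply: idealD => //; first exact: idealN.
by apply: ideal_conj => //; apply: ideal_lam => //; exact: ideal_circ_conj.
Qed.

Lemma star_set_subl I J : ideal I -> star_set I J `<=` I.
Proof.
move=> Ii; apply: star_set_sub_subgroup => [|a b Ia _]; last exact: ideal_starl.
by case: Ii => [[]].
Qed.

Lemma star_set_subr I J : ideal J -> star_set I J `<=` J.
Proof.
move=> Ji; apply: star_set_sub_subgroup => [|a b _ Jb]; last exact: ideal_starr.
by case: Ji => [[]].
Qed.

(** Solving [star_addr] for the conjugate of [star a c] leaves two generators, as [b + c] stays in
    [J]. *)
Lemma star_set_conjr I J b s : ideal J -> J b -> star_set I J s ->
  star_set I J (b + s - b).
Proof.
move=> Ji Jb; have [_ gD gN] := star_set_subgroup I J.
apply: (star_set_map (conj_morph b)) => [|a c Ia Jc].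
  exact: star_set_subgroup.
have -> : b + star a c - b = - star a b + star a (b + c).
  by rewrite star_addr !group_simp.
apply: gD; first by apply: gN; exact: star_set_gen.
by apply: star_set_gen => //; exact: idealD.
Qed.

Lemma neq_set0P I : ideal I -> I <> [set 0] -> exists2 x, I x & x <> 0.
Proof.
move=> Ii; apply: contra_notP => h; apply/seteqP; split=> x /=.
  by move=> Ix; apply: contrapT => x0; apply: h; exists x.
by move=> ->; exact: ideal0.
Qed.

(** * Consequences of two-sidedness *)

Hypothesis tsA : two_sided A.

(** Distribute over [d], the [∘]-inverse of [c], on the right and over [c] on the left: the leftover
    [- c + c ∘ (- d) - c] vanishes because [c ∘ (- d) = c + c]. *)
Lemma circ_conj_morph c : {morph circ_conj c : x y / x + y}.
Proof.
move=> x y; rewrite /circ_conj -!gopA tsA.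
set d := ginv _ c.
have cN : c ∘ (- d) = c + c.
  have := brace_distr c d (- d).
  rewrite [d - d]gopVr circ0 [c ∘ d]gopVr brace_one gop1l => e.
  by apply: (@gop_injl _ (brace_add A) (- c)); rewrite -e !group_simp.
by rewrite !brace_distr cN !group_simp.
Qed.

Lemma circ_conj_circ c x y : circ_conj c (x ∘ y) = circ_conj c x ∘ circ_conj c y.
Proof. by rewrite /circ_conj !group_simp. Qed.

Lemma circ_conjV a b : circ_conj a (circ_conj (ginv (brace_circ A) a) b) = b.
Proof. by rewrite /circ_conj !group_simp. Qed.

Lemma circ_conj_star c a b :
  circ_conj c (star a b) = star (circ_conj c a) (circ_conj c b).
Proof.
by rewrite /star !circ_conj_morph !(morph_ginv (circ_conj_morph c)) circ_conj_circ.
Qed.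

Lemma star_addl a b c : star (a + b) c = - b + star a c + b + star b c.
Proof. by rewrite /star tsA !group_simp. Qed.

(** The mirror image of [star_set_conjr], obtained from [star_addl]. *)
Lemma star_set_conjl I J b s : ideal I -> I b -> star_set I J s ->
  star_set I J (b + s - b).
Proof.
move=> Ii Ib; have [_ gD gN] := star_set_subgroup I J.
apply: (star_set_map (conj_morph b)) => [|a c Ia Jc].
  exact: star_set_subgroup.
have -> : b + star a c - b = star (a - b) c - star (- b) c.
  by rewrite star_addl !group_simp.
have INb : I (- b) by exact: idealN.
apply: gD; last by apply: gN; exact: star_set_gen.
by apply: star_set_gen => //; exact: idealD.
Qed.

(* Expand [(a + b) ∘ (c + d)] by the two distributive laws in both orders. *)
Lemma star_commute a b c d :
  star a d + (- c + b ∘ c - b) = (- c + b ∘ c - b) + star a d.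
Proof.
have e : (a + b) ∘ (c + d) = (a + b) ∘ (c + d) by [].
rewrite [LHS]tsA [RHS]brace_distr !brace_distr !tsA in e.
rewrite /star; apply: (@gop_injl _ (brace_add A) (a ∘ c)).
apply: (@gop_injr _ (brace_add A) (b ∘ d)).
by move: e; rewrite !group_simp.
Qed.

(** Both [lam c] and [circ_conj c] are additive and send generators to generators, so only additive
    normality remains to be supplied. *)
Lemma ideal_star_set I J : ideal I -> ideal J ->
  (forall b s, star_set I J s -> star_set I J (b + s - b)) ->
  ideal (star_set I J).
Proof.
move=> Ii Ji conjIJ; have IJg := star_set_subgroup I J.
apply: ideal_of_invariant => // c x.
- apply: (star_set_map (lamD c)) => // a b Ia Jb.
  rewrite lam_star; apply: star_set_gen; first exact: ideal_circ_conj.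
  exact: ideal_lam.
- apply: (star_set_map (circ_conj_morph c)) => // a b Ia Jb.
  by rewrite circ_conj_star; apply: star_set_gen; exact: ideal_circ_conj.
Qed.

Lemma ideal_star_setT : ideal (star_set [set: A] [set: A]).
Proof.
apply: ideal_star_set; [exact: ideal_setT..|move=> b s].
by apply: star_set_conjr; first exact: ideal_setT.
Qed.

(** With [x = b + a - b], expanding [star (a - b) c = star (- b + x) c] in two ways writes the
    conjugate of [star a c] by [b] as a commutator of elements of [I] and [J] plus a conjugate of
    [star x c] by an element of [J]. *)
Lemma ideal_star_set_of_commutators I J : ideal I -> ideal J ->
  (forall x y, I x -> J y -> star_set I J (- y + x + y - x)) ->
  ideal (star_set I J).
Proof.
move=> Ii Ji IJcomm; apply: ideal_star_set => // b s.
have [_ gD gN] := star_set_subgroup I J.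
apply: (star_set_map (conj_morph b)) => [|a c Ia Jc].
  exact: star_set_subgroup.
(* Move [- b] to the left of [a] before using the right distributive law. *)
set x := b + a - b; set y := star (- b) c.
have Ix : I x by exact: ideal_conj.
have Jy : J y by exact: ideal_starr.
have -> : b + star a c - b = - (- - y - x - y - - x) + (y + star x c - y).
  have := star_addl (- b) x c; have := star_addl a (- b) c.
  have -> : - b + x = a - b by rewrite /x !group_simp.
  move=> ->; rewrite -/y => e; apply: (@gop_injr _ (brace_add A) y).
  by move: e; rewrite !group_simp.
apply: gD; last by apply: star_set_conjr => //; exact: star_set_gen.
by apply: gN; apply: IJcomm; exact: idealN.
Qed.

(** * Centralizers and additive commutators *)

Definition centralizer X : set A := [set x | forall y, X y -> x + y = y + x].

(** Additive conjugations, [lam a] and [circ_conj a] are additive automorphisms mapping [I] onto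
    itself, so they preserve its centralizer. *)
Lemma ideal_centralizer I : ideal I -> ideal (centralizer I).
Proof.
move=> Ii; apply: ideal_of_invariant.
- split=> [y _|x y hx hy z Iz|x hx z Iz] /=.
  + by rewrite !group_simp.
  + by rewrite -gopA hy // gopA hx // gopA.
  + apply: (@gop_injl _ (brace_add A) x); rewrite gopVK gopA hx //.
    by rewrite !group_simp.
- move=> b x hx y Iy /=; have := hx _ (ideal_conjV b Ii Iy) => e.
  apply: (@gop_injl _ (brace_add A) (- b)).
  apply: (@gop_injr _ (brace_add A) b).
  by move: e; rewrite !group_simp.
- move=> a x hx y Iy; rewrite -[y](lamV a) -!lamD hx //.
  exact: ideal_lam.
- move=> a x hx y Iy; rewrite -[y](circ_conjV a) -!circ_conj_morph hx //.
  exact: ideal_circ_conj.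
Qed.

(* The witness is the centre of [A * A] if it is nonzero, and [A * A] itself
   otherwise. *)
Lemma exists_commutator_absorbing_ideal : prime_brace A ->
  [set: A] <> [set 0] ->
  exists2 M, nonzero_ideal M & forall I J, ideal I -> ideal J ->
    I `<=` M -> J `<=` M ->
    forall x y, I x -> J y -> star_set I J (- y + x + y - x).
Proof.
move=> pA A0; set A2 := star_set [set: A] [set: A].
have A2i : ideal A2 by exact: ideal_star_setT.
have Ki := ideal_setI A2i (ideal_centralizer A2i).
have [K0|K0] := pselect (A2 `&` centralizer A2 = [set 0]); last first.
  exists (A2 `&` centralizer A2) => // I J _ _ IK JK x y Ix Jy.
  have [A2x _] := IK _ Ix; have [_ Cy] := JK _ Jy.
  have -> : - y + x + y - x = 0.
    by rewrite -[- y + x + y]gopA -Cy // !group_simp.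
  by case: (star_set_subgroup I J).
exists A2 => [|I J Ii Ji IA2 JA2 x y Ix Jy].
  by split=> //; apply: pA; split=> //; exact: ideal_setT.
(* [star_commute] makes [w] commute with the generators of [A2], and [w] lies in [A2]; the trivial
   centre then forces [w = 0]. *)
set w := - y + x ∘ y - x.
have w0 : w = 0.
  suff : (A2 `&` centralizer A2) w by rewrite K0.
  split.
    have A2x := IA2 _ Ix; have A2y := JA2 _ Jy.
    have A2s : A2 (star x y) by exact: star_set_gen.
    rewrite /w circ_star; apply: (idealD A2i _ (idealN A2i A2x)).
    apply: (idealD A2i (idealN A2i A2y)).
    by apply: (idealD A2i _ A2y); exact: (idealD A2i A2x).
  (* The elements commuting with [w] form an additive subgroup, so the generators of [A2]
     suffice. *)
  move=> z A2z; have : (centralizer [set w]) z.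
    move: z A2z; apply: star_set_sub_subgroup; last first.
      by move=> a b _ _ _ ->; exact: star_commute.
    split=> [_ ->|s t hs ht _ ->|s hs _ ->]; first by rewrite !group_simp.
      by rewrite -gopA ht // gopA hs // gopA.
    apply: (@gop_injl _ (brace_add A) s); rewrite gopVK gopA hs //.
    by rewrite !group_simp.
  by move=> ->.
(* Since [w = 0], the commutator is the negative of [star x y] conjugated by [x] in [I], then by
   [- y] in [J]. *)
have -> : - y + x + y - x = - (- y + (x + star x y - x) - - y).
  have -> : - y + x + y - x =
      - (- y + (x + star x y - x) - - y) + w.
    by rewrite /w circ_star !group_simp.
  by rewrite w0 gop1r.
have [_ _ gN] := star_set_subgroup I J.
apply: gN; apply: star_set_conjr => //; first exact: idealN.
by apply: star_set_conjl => //; exact: star_set_gen.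
Qed.

(** * From two factors to arbitrary bracketed products *)

Lemma prime_strongly_prime : prime_brace A -> strongly_prime_brace A.
Proof.
move=> pA X XP.
(* A product has at least one factor, which is a nonzero ideal. *)
have A0 : [set: A] <> [set 0].
  elim: XP => // I [Ii In0] A0.
  have [x Ix x0] := neq_set0P Ii In0.
  by apply: x0; have : [set: A] x by []; rewrite A0.
have [M [Mi M0] Mcomm] := exists_commutator_absorbing_ideal pA A0.
(* [X] is not known to be an ideal, so the induction carries a nonzero ideal contained in both [M]
   and [X]. *)
have [I [Ii I0] [IM IX]] : exists2 I, nonzero_ideal I & I `<=` M /\ I `<=` X.
  elim: XP => [I In|Y Z _ [I [Ii I0] [IM IY]] _ [J [Ji J0] [JM JZ]]].
    exists (I `&` M); last by split=> x [].
    have [Ii _] := In; split; first exact: ideal_setI.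
    have IMi : ideal M by [].
    (* [star_set I M] lies in the intersection of [I] and [M], so primeness makes that intersection
       nonzero. *)
    move=> IM0; apply: (pA I M) => //; apply/seteqP; split=> x /=.
      by move=> h; rewrite -[x = 0]/([set 0] x) -IM0; split;
        [exact: star_set_subl h|exact: star_set_subr h].
    by move=> ->; case: (star_set_subgroup I M).
  exists (star_set I J); last first.
    split; first by move=> x /(star_set_subl Ii)/IM.
    exact: star_setS.
  split; last by apply: pA.
  by apply: ideal_star_set_of_commutators => //; exact: Mcomm.
have [x Ix x0] := neq_set0P Ii I0.
by move=> X0; apply: x0; have := IX _ Ix; rewrite X0.
Qed.

End SkewBrace.

Theorem theorem5p6 (A : skew_brace) (hA : two_sided A) :
  prime_brace A <-> strongly_prime_brace A.
Proof.
split; first exact: prime_strongly_prime.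
by move=> spA I J nI nJ; apply/spA/star_product_star; exact: star_product_factor.
Qed.
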